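(* Let $$A=\begin{bmatrix}0&0&0&1&0&0\\0&0&0&0&b&0\\0&0&0&0&c&e\\0&0&0&0&d&f\\0&0&0&0&0&g\\0&0&0&0&0&h\end{bmatrix},$$ where $b,c,d,e,h\ge0$, $f,g\in\mathbb R$, $f\ge0$ if $ce=0$ and $f\le0$ otherwise, $b^2+c^2+d^2=1$, $e^2+f^2+g^2+h^2=1$, $ce+df=0$, and $c=0$ whenever $e=0$. Assume in addition that $h\ne0$ and $cg=0$. Then $C(A)$ contains a (non-degenerate) circle different from $\mathcal C_{1/2}$ if and only if $d\ne0$ and $c=g=0$. If these conditions hold, then $$C(A)=\mathcal C_{\sqrt{1-d}/2}\cup\mathcal C_{\sqrt{1+d}/2}\cup E,$$ where $E$ is the ellipse with the foci $0,h$ and major axis of length one.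
   Context: Put $\operatorname{Re}X=(X+X^* )/2$. The Kippenhahn polynomial of $A\in\mathbb C^{n\times n}$ is $P_A(\lambda,\theta)=\det(\operatorname{Re}(e^{i\theta}A)-\lambda I)$. With $\lambda_1(\theta),\dots,\lambda_n(\theta)$ its roots in $\lambda$, the Kippenhahn curve $C(A)$ is the envelope of the family of lines $\{e^{-i\theta}(\lambda_j(\theta)+i\mathbb R):\theta\in(-\pi,\pi],\ j=1,\dots,n\}$. $\mathcal C_{a,r}$ is the circle of radius $r$ centered at $a$, $\mathcal C_r=\mathcal C_{0,r}$, and $\mathcal C_0=\{0\}$ by convention. For $r>0$, $C(A)\supset\mathcal C_r$ if and only if, for all $\theta$, $P_A(\lambda,\theta)$ is divisible by $\lambda^2-r^2$ as a polynomial in $\lambda$; and $C(A)\supset\mathcal C_{a,r}$ if and only if $C(A-aI)\supset\mathcal C_r$. The Kippenhahn curve of a direct sum is the union of the Kippenhahn curves of the summands. The ellipse $E$ is the Kippenhahn curve of $\begin{bmatrix}0&\sqrt{1-h^2}\\0&h\end{bmatrix}$; in the degenerate case $h=1$ it is understood as the pair of its foci $\{0,1\}$. *)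

(* Defs.v *)
From HB Require Import structures.
From mathcomp Require Import all_boot all_order all_algebra.
From mathcomp Require Import all_classical all_reals all_analysis.
From mathcomp Require Import complex.

Set Implicit Arguments.
Unset Strict Implicit.
Unset Printing Implicit Defensive.

Import Order.TTheory GRing.Theory Num.Theory.
Import numFieldNormedType.Exports.

Local Open Scope classical_set_scope.
Local Open Scope ring_scope.
Local Open Scope complex_scope.

(* e^{i theta} *)
Definition cis (R : realType) (theta : R) : R[i] := cos theta +i* sin theta.

(* Re X = (X + X^* ) / 2, with X^* the conjugate transpose *)
Definition mxRe (R : realType) (n : nat) (X : 'M[R[i]]_n) : 'M[R[i]]_n :=
  2^-1 *: (X + map_mx (@conjc R) X^T).

(* Only real values of lambda are needed: the roots are eigenvalues of a
   Hermitian matrix. *)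
Definition kippenhahn_poly (R : realType) (n : nat) (A : 'M[R[i]]_n)
    (lambda theta : R) : R[i] :=
  \det (mxRe (cis theta *: A) - (lambda%:C)%:M).

(* e^{-i theta} (p + i RR) *)
Definition line (R : realType) (theta p : R) : set R[i] :=
  [set cis (- theta) * (p +i* s) | s in [set: R]].

(* The envelope of the lines [line theta p], for theta in (-pi, pi] and
   F theta p.  [line t p] has the equation Re (e^{i t} z) - p = 0; along a
   differentiable local branch t |-> lambda t of F, the point z is on the
   envelope when this equation and its derivative in t hold at t = theta,
   that is, z = e^{-i theta} (lambda theta - i lambda' theta). *)
Definition envelope (R : realType) (F : R -> R -> Prop) : set R[i] :=
  [set z | exists (theta : R) (lambda : R -> R),
    [/\ - pi < theta <= pi,
        \forall t \near theta, F t (lambda t) /\ derivable lambda t 1,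
        line theta (lambda theta) z &
        is_derive theta (1 : R)
          (fun t : R => complex.Re (cis t * z) - lambda t) 0]].

Definition kippenhahn_curve (R : realType) (n : nat) (A : 'M[R[i]]_n) :
    set R[i] :=
  envelope (fun theta p => kippenhahn_poly A p theta = 0).

(* For r = 0 this is the singleton of a. *)
Definition circle (R : realType) (a : R[i]) (r : R) : set R[i] :=
  [set z | `|z - a| = r%:C].

(* The ellipse with foci z1, z2 and major axis of length l; when l is the
   distance between the foci it degenerates, by convention, to the pair of the
   foci and not to the segment joining them. *)
Definition ellipse (R : realType) (z1 z2 : R[i]) (l : R) : set R[i] :=
  if `|z1 - z2| == l%:C then [set z1; z2]
  else [set z | `|z - z1| + `|z - z2| = l%:C].

Definition mxA (R : realType) (b c d e f g h : R) : 'M[R[i]]_6 :=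
  \matrix_(i < 6, j < 6)
    (nth 0 (nth [::] [:: [:: 0; 0; 0; 1; 0; 0];
                         [:: 0; 0; 0; 0; b; 0];
                         [:: 0; 0; 0; 0; c; e];
                         [:: 0; 0; 0; 0; d; f];
                         [:: 0; 0; 0; 0; 0; g];
                         [:: 0; 0; 0; 0; 0; h]] i) j)%:C.

(* Main.v *)
Require Import Defs.
From mathcomp Require Import all_boot all_order all_algebra.
From mathcomp Require Import all_classical all_reals all_analysis.
From mathcomp Require Import complex ring lra zify.

Set Implicit Arguments.
Unset Strict Implicit.
Unset Printing Implicit Defensive.

Import Order.TTheory GRing.Theory Num.Theory.
Import numFieldNormedType.Exports.

Local Open Scope classical_set_scope.
Local Open Scope ring_scope.
Local Open Scope complex_scope.

(** Put [x = - 2 * lambda] and [C = cos theta]. Expanding the determinant, and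
    using the relations between the entries, gives
    [2 ^+ 6 * P_A = E.[x] + C * O.[x]] with [E = even_part b d e h] even, monic
    of degree 6, and [O = odd_part d f g h] odd, of degree 5 and leading
    coefficient [2 * h] ([kippenhahn_poly_eq0]). A point [X + i Y] of the curve
    comes from a differentiable branch [x] of this equation, through
    [X = - (x cos t - x' sin t) / 2] and [Y = (x sin t + x' cos t) / 2]
    ([kippenhahn_curve_branch]).

    A circle in the curve is centred at 0, and [E], [O] have a common root [a]
    with [a ^+ 2 = 4 * r ^+ 2] ([circle_in_branches]). To see this, divide [E]
    and [O] by their common real roots, which gives [p] and [q]. A branch
    through a common root [a] has [x = a] and [x' = 0] there, by
    [near_prod_double_zero], and its point lies on the circle of radius
    [|a| / 2] around 0. Apart from such points, and from those with
    [sin t = 0], the curve is parametrized by [x], because [cos t = - p / q];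
    call the point [Z x]. If infinitely many lines of this family were tangent
    to the circle, then a polynomial in [x], the tangency polynomial, would be
    zero; its leading coefficient shows that the centre is [h], and then the
    parities of [E] and [O] contradict [r <> 0]. The velocity of [Z] has the direction of the line, so where
    [Z x] is on the circle and the line is not tangent to it, either
    [Z' x != 0] and [x] is isolated among the parameters of points of the
    circle, or [Z' x = 0]. The latter is a polynomial equation in [x]: it has
    finitely many solutions unless [Z] is locally constant. In all cases only
    countably many points of the circle are reached ([countable_branch]),
    although a circle of positive radius is uncountable.

    A nonzero common root with [a ^+ 2 <> 1] forces [d <> 0] and [c = g = 0], by
    elementary algebra ([common_root_case]). In that case [f = 0] and
    [E.[x] + C * O.[x]] is the product of [x ^+ 2 - (1 - d)],
    [x ^+ 2 - (1 + d)] and [x ^+ 2 + 2 * h * C * x - (1 - h ^+ 2)]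
    ([split_parts]). The first two factors are the circles and the last one is
    the ellipse ([split_curveE]). *)

(** * Zeros of differentiable functions *)

Section Zeros.
Variable R : realType.
Implicit Types (f g X : R -> R) (x t l : R).

Lemma is_derive_continuous f x l : is_derive x 1 f l -> f y @[y --> x] --> f x.
Proof.
move=> [df _]; apply: differentiable_continuous; exact/derivable1_diffP.
Qed.

(** A zero which is not a double zero is isolated. *)
Lemma near_neq0 f x l : is_derive x 1 f l -> f x != 0 \/ l != 0 ->
  \forall y \near x, y != x -> f y != 0.
Proof.
move=> fl [fx0|l0].
  have fn0 : \forall y \near x, f y != 0.
    exact: (cvgr_neq0 (f x) (is_derive_continuous fl)).
  by near=> y => _; near: y.
have [fx0|fx0] := eqVneq (f x) 0; last first.
  have fn0 : \forall y \near x, f y != 0.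
    exact: (cvgr_neq0 (f x) (is_derive_continuous fl)).
  by near=> y => _; near: y.
have [df dfl] := fl.
have cv : (h^-1 *: ((f \o shift x) (h *: (1 : R)) - f x)) @[h --> 0^'] --> l.
  by rewrite -dfl; exact: df.
have := cvgr_neq0 l cv l0.
rewrite /= fx0 near_withinE => /(_ _)/nbhs_ballP[e e0 he].
apply/nbhs_ballP; exists e => //= y xy yx.
have := he (y - x); rewrite /ball /= sub0r opprB => /(_ xy).
rewrite subr_eq0 => /(_ yx); rewrite subr0 scaler1 subrK.
by apply: contraNneq => ->; rewrite scaler0.
Unshelve. all: by end_near. Qed.

Lemma not_near_eq x : ~ \forall y \near x, y = x.
Proof.
move=> /nbhs_ballP[e /= e0 he].
have := he (x + e / 2); rewrite /ball /= opprD addrA subrr sub0r normrN.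
rewrite ger0_norm ?divr_ge0 ?(ltW e0) // ltr_pdivrMr // mulr_natr mulr2n ltrDl.
by move=> /(_ e0); move: e0; lra.
Qed.

Lemma derive0_near_cst f x : (\forall y \near x, is_derive (y : R) 1 f 0) ->
  \forall y \near x, f y = f x.
Proof.
move=> /nbhs_ballP[e /= e0 he].
apply/nbhs_ballP; exists e => //= y.
wlog suff main : / forall a b, a < b -> ball x e a -> ball x e b -> f a = f b.
  move=> xy; have xx : ball x e x by exact: ballxx.
  by have [yx|yx|->//] := ltgtP y x; [exact: main|apply/esym/main].
move=> a b ab ha hb.
have sub z : z \in `[a, b]%R -> ball x e z.
  rewrite in_itv /= => /andP[az zb].
  move: ha hb; rewrite /ball /= !ltr_distl => /andP[h1 h2] /andP[h3 h4].
  by apply/andP; split; lra.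
have [||c _] := @MVT R f (fun=> 0) a b ab.
- move=> z zab; apply: he; apply: sub; exact: subset_itv_oo_cc.
- apply: derivable_within_continuous => z zab.
  by have [] := he _ (sub _ zab).
by rewrite mul0r => /eqP; rewrite subr_eq0 => /eqP.
Qed.

(** A function which is locally constant on a set of reals takes only
    countably many values there. *)
Lemma countable_locally_cst (A : set R) X :
  (forall x, A x -> \forall y \near x, A y -> X y = X x) ->
  countable (X @` A).
Proof.
move=> AX.
pose B (p : rat * rat) : set R := [set r | exists x,
  [/\ A x, ratr p.1 < x < ratr p.2, r = X x &
      forall y, A y -> ratr p.1 < y < ratr p.2 -> X y = X x]].
apply: (@sub_countable _ _ _ (\bigcup_(p in setT) B p)).
  apply: subset_card_le => _ [x Ax <-].
  have /nbhs_ballP[e /= e0 he] := AX x Ax.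
  have [|p] := @rat_in_itvoo R (x - e) x; first by lra.
  rewrite in_itv /= => /andP[p1 p2].
  have [|q] := @rat_in_itvoo R x (x + e); first by lra.
  rewrite in_itv /= => /andP[q1 q2].
  exists (p, q) => //; exists x; split => //=; first by rewrite p2 q1.
  move=> y Ay /andP[y1 y2]; apply: he => //.
  by rewrite /ball /= ltr_distlC; apply/andP; split; lra.
apply: bigcup_countable => // -[p q] _.
have [[r Br]|B0] := pselect (exists r, B (p, q) r); last first.
  suff -> : B (p, q) = set0 by [].
  by rewrite -subset0 => r Br; apply: B0; exists r.
suff -> : B (p, q) = [set r] by exact: countable1.
apply/seteqP; split=> [s|s ->//].
move: Br => [x [Ax px -> _]] [y [Ay py -> hy]].
by rewrite /= (hy x).
Qed.
End Zeros.

(** Differentiation rules for functions in applied form. *)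
Section DeriveExpr.
Variable R : realType.
Implicit Types (f g : R -> R) (x l m : R).

Lemma is_derive_add f g x l m : is_derive x 1 f l -> is_derive x 1 g m ->
  is_derive x 1 (fun y => f y + g y) (l + m).
Proof. exact: is_deriveD. Qed.

Lemma is_derive_mul f g x l m : is_derive x 1 f l -> is_derive x 1 g m ->
  is_derive x 1 (fun y => f y * g y) (l * g x + f x * m).
Proof.
move=> fl gm; apply: (is_derive_eq (is_deriveM fl gm)).
by rewrite /GRing.scale /= addrC [g x * l]mulrC.
Qed.

Lemma is_derive_div f g x l m : g x != 0 ->
  is_derive x 1 f l -> is_derive x 1 g m ->
  is_derive x 1 (fun y => f y / g y) ((l * g x - f x * m) / g x ^+ 2).
Proof.
move=> g0 fl gm; apply: (is_derive_eq (is_derive_mul fl (is_deriveV g0 gm))).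
by rewrite /GRing.scale /=; field.
Qed.

Lemma is_derive_pcomp (p : {poly R}) f x l : is_derive x 1 f l ->
  is_derive x 1 (fun y => p.[f y]) (p^`().[f x] * l).
Proof. by move=> fl; apply: (@is_derive1_comp R (horner p) f). Qed.
End DeriveExpr.

(** If a product of differentiable functions vanishes near a point, then one
    of its factors has a double zero there. *)
Lemma near_prod_double_zero (R : realType) (rs : seq R) (x g : R -> R) (t x1 g1 : R) :
  is_derive t 1 x x1 -> is_derive t 1 g g1 ->
  (\forall s \near t, g s * (\prod_(a <- rs) ('X - a%:P)).[x s] = 0) ->
  (exists2 a, a \in rs & x t = a /\ x1 = 0) \/ (g t = 0 /\ g1 = 0).
Proof.
move=> xd gd H; apply: contrapT => /not_orP[nrs /not_andP ng].
have gn : \forall s \near t, s != t -> g s != 0.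
  apply: (near_neq0 gd); case: ng => /eqP; [by left|by right].
have rn : \forall s \near t, s != t -> (\prod_(a <- rs) ('X - a%:P)).[x s] != 0.
  elim: rs nrs {H} => [|a rs IH] nrs.
    by near=> s => _; rewrite big_nil hornerC oner_neq0.
  have {}IH : \forall s \near t, s != t ->
      (\prod_(a <- rs) ('X - a%:P)).[x s] != 0.
    apply: IH => -[b hb h]; apply: nrs; exists b => //.
    by rewrite in_cons hb orbT.
  have an : \forall s \near t, s != t -> x s + - a != 0.
    have xad := is_derive_add xd (is_derive_cst (- a : R) t (1 : R)).
    apply: (near_neq0 xad); rewrite addr0 subr_eq0.
    have [x1z|] := eqVneq x1 0; [left|by right].
    by apply/eqP => xa; apply: nrs; exists a; rewrite ?mem_head.
  near=> s => st; rewrite big_cons hornerM mulf_neq0 // ?hornerXsubC.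
    by move: st; near: s.
  by move: st; near: s.
apply: (@not_near_eq _ t); near=> s; apply/eqP; apply: contraT => st.
have : g s * (\prod_(a <- rs) ('X - a%:P)).[x s] = 0 by near: s.
have gs : g s != 0 by move: st; near: s.
have rss : (\prod_(a <- rs) ('X - a%:P)).[x s] != 0 by move: st; near: s.
by move/eqP; rewrite mulf_eq0 (negbTE gs) (negbTE rss).
Unshelve. all: by end_near. Qed.

(** * Countable sets and polynomials *)

Lemma countable_setU T (A B : set T) :
  countable A -> countable B -> countable (A `|` B).
Proof.
move=> cA cB; have -> : A `|` B = \bigcup_(i in [set: bool]) if i then A else B.
  apply/seteqP; split=> x.
    by move=> [Ax|Bx]; [exists true|exists false].
  by move=> [[] _ hx]; [left|right].
by apply: bigcup_countable => // -[].
Qed.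

Lemma countable_roots (R : realType) (p : {poly R}) : p != 0 ->
  countable [set x : R | root p x].
Proof.
elim: {p}(size p) {-2}p (leqnn (size p)) => [|n IH] p.
  by rewrite leqn0 size_poly_eq0 => ->.
move=> sp p0; have [[a pa]|nr] := pselect (exists a, root p a); last first.
  suff -> : [set x | root p x] = set0 by [].
  by rewrite -subset0 => x px; apply: nr; exists x.
have /factor_theorem[q pq] := pa.
have q0 : q != 0 by apply: contraNneq p0 => q0; rewrite pq q0 mul0r.
have -> : [set x | root p x] = [set a] `|` [set x | root q x].
  apply/seteqP; split=> x /=; rewrite pq rootM root_XsubC.
    by move=> /orP[->|/eqP]; [right|left].
  by move=> [->|->] //; rewrite eqxx orbT.
apply: countable_setU; first exact: countable1.
by apply: IH => //; move: sp; rewrite pq size_mul ?polyXsubC_eq0 // size_XsubC addn2.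
Qed.

Lemma uncountable_itv (R : realType) (a b : R) : a < b ->
  ~ countable ([set` `[a, b]] : set R).
Proof.
move=> ab /countable_lebesgue_measure0.
rewrite lebesgue_measure_itv /= lte_fin ab -EFinB => -[] /eqP.
by rewrite subr_eq0 (gt_eqF ab).
Qed.

Lemma split_common_roots (F : idomainType) (p q : {poly F}) : p != 0 ->
  exists (rs : seq F) (p1 q1 : {poly F}),
    [/\ p = p1 * \prod_(a <- rs) ('X - a%:P), q = q1 * \prod_(a <- rs) ('X - a%:P) &
        forall x, root p1 x -> ~~ root q1 x].
Proof.
elim: {p}(size p) {-2}p q (leqnn (size p)) => [|n IH] p q.
  by rewrite leqn0 size_poly_eq0 => ->.
move=> sp p0.
have [[a /andP[pa qa]]|nr] := pselect (exists a, root p a && root q a); last first.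
  exists [::], p, q; split; rewrite ?big_nil ?mulr1 // => x px.
  by apply/negP => qx; apply: nr; exists x; rewrite px.
have /factor_theorem[p' pE] := pa; have /factor_theorem[q' qE] := qa.
have p'0 : p' != 0 by apply: contraNneq p0 => p'0; rewrite pE p'0 mul0r.
have [|rs [p1 [q1 [p1E q1E h]]]] := IH p' q' _ p'0.
  by move: sp; rewrite pE size_mul ?polyXsubC_eq0 // size_XsubC addn2.
by exists (a :: rs), p1, q1; split; rewrite // big_cons mulrCA mulrC -?p1E -?q1E.
Qed.

Lemma coefM_top (F : nzRingType) (p q : {poly F}) m n :
  (size p <= m.+1)%N -> (size q <= n.+1)%N -> (p * q)`_(m + n) = p`_m * q`_n.
Proof.
move=> sp sq; rewrite coefM.
have hm : (m < (m + n).+1)%N by rewrite ltnS leq_addr.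
rewrite (bigD1 (Ordinal hm)) //= addKn big1 ?addr0 // => i im.
have {}im : (i : nat) != m by [].
have [mi|im'] := ltnP m i.
  by rewrite [p`_i]nth_default ?mul0r // (leq_trans sp).
rewrite [q`_(_ - _)]nth_default ?mulr0 //.
by rewrite (leq_trans sq) // ltn_subRL; lia.
Qed.

(** * Rational branches meet a circle in countably many points *)

(** A rational branch is the part of the curve of [p.[x] + cos t * q.[x] = 0]
    on which [cos t = - p.[x] / q.[x]]. It is parametrized by [x], and
    [sg = 1] or [sg = -1] is the sign of [sin t]. *)
Section RationalBranch.
Variables (R : realType) (p q : {poly R}) (sg : R).
Hypothesis sg2 : sg ^+ 2 = 1.
Let sg0 : sg != 0.
Proof. by rewrite -sqrf_eq0 sg2 oner_eq0. Qed.

(** The derivative of [p / q] is [wronsk / q ^+ 2]. *)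
Definition wronsk : {poly R} := p^`() * q - p * q^`().
Local Notation W := wronsk.

(** The parameters at which [t] is locally a differentiable function of [x],
    and conversely: [q], [sin t] and the derivative of [p / q] do not vanish. *)
Definition branch_dom (x : R) :=
  [/\ q.[x] != 0, W.[x] != 0 & 0 < 1 - (p.[x] / q.[x]) ^+ 2].

(** The value of [sin t] at the parameter [x]. *)
Definition branch_sin (x : R) := sg * Num.sqrt (1 - (p.[x] / q.[x]) ^+ 2).

(** The real part of the point of the envelope with parameter [x]; it does not
    depend on the sign of [sin t]. Here [x'] has been eliminated through
    [x' = sin t * q ^+ 2 / wronsk]. *)
Definition branch_re (x : R) :=
  (x * (p.[x] / q.[x]) + (q.[x] ^+ 2 - p.[x] ^+ 2) / W.[x]) / 2.

(** The imaginary part of the point of the envelope with parameter [x]. *)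
Definition branch_im (x : R) :=
  branch_sin x * (x - p.[x] * q.[x] / W.[x]) / 2.

(** The numerator of the velocity of the point of the envelope with parameter
    [x]. Both components of the velocity are multiples of it. *)
Definition branch_speed : {poly R} :=
  p * q * W ^+ 2 + 'X * W ^+ 3 +
  q ^+ 2 * (2%:P * (q * q^`() - p * p^`()) * W - (q ^+ 2 - p ^+ 2) * W^`()).

Let wronskE x : W.[x] = p^`().[x] * q.[x] - p.[x] * q^`().[x].
Proof. by rewrite /wronsk !hornerE. Qed.

Let speedE x : branch_speed.[x] =
  p.[x] * q.[x] * W.[x] ^+ 2 + x * W.[x] ^+ 3 +
  q.[x] ^+ 2 * (2 * (q.[x] * q^`().[x] - p.[x] * p^`().[x]) * W.[x]
                - (q.[x] ^+ 2 - p.[x] ^+ 2) * W^`().[x]).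
Proof. by rewrite /branch_speed; move: W => w; rewrite !hornerE. Qed.

Let is_derive_horner (r : {poly R}) (x : R) : is_derive x 1 (fun y => r.[y]) (r^`().[x]).
Proof. exact: is_derive_poly. Qed.

Lemma branch_sin_sqr x : branch_dom x ->
  branch_sin x ^+ 2 = 1 - (p.[x] / q.[x]) ^+ 2.
Proof. by case=> _ _ h; rewrite exprMn sg2 mul1r sqr_sqrtr ?ltW. Qed.

Lemma branch_sin_neq0 x : branch_dom x -> branch_sin x != 0.
Proof.
move=> hx; rewrite -sqrf_eq0 branch_sin_sqr //; by case: hx => _ _ /lt0r_neq0.
Qed.

Lemma is_derive_branch_re x : branch_dom x ->
  is_derive x 1 branch_re (branch_speed.[x] / (2 * q.[x] ^+ 2 * W.[x] ^+ 2)).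
Proof.
move=> [q0 W0 _].
have dp := is_derive_horner p x; have dq := is_derive_horner q x.
have dW := is_derive_horner W x; have dx := is_derive_id x (1 : R).
have dC (c : R) := is_derive_cst c x (1 : R).
have d1 := is_derive_mul dx (is_derive_div q0 dp dq).
have d2 := is_derive_div W0 (is_derive_add (is_derive_mul dq dq)
  (is_derive_mul (dC (-1)) (is_derive_mul dp dp))) dW.
have d3 := is_derive_mul (is_derive_add d1 d2) (dC 2^-1).
apply: (near_eq_is_derive _ (is_derive_eq d3 _)).
  by near=> y; rewrite /branch_re /=; ring.
rewrite speedE /=; move: W0 (W^`().[x]) => W0 w1.
move: W0; rewrite wronskE => W0; field.
by rewrite q0 W0.
Unshelve. all: by end_near. Qed.

(** The velocity has the direction of the line of the branch: its components
    are proportional to [sin t] and [cos t]. *)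
Lemma is_derive_branch_im x : branch_dom x ->
  is_derive x 1 branch_im (- (p.[x] / (q.[x] * branch_sin x) *
   (branch_speed.[x] / (2 * q.[x] ^+ 2 * W.[x] ^+ 2)))).
Proof.
move=> dom; have [q0 W0 pos] := dom.
have s2 := branch_sin_sqr dom; have s0 := branch_sin_neq0 dom.
have dp := is_derive_horner p x; have dq := is_derive_horner q x.
have dW := is_derive_horner W x; have dx := is_derive_id x (1 : R).
have dC (c : R) := is_derive_cst c x (1 : R).
have d1 := is_derive_div q0 dp dq.
have d2 := is_derive_add (dC 1) (is_derive_mul (dC (-1)) (is_derive_mul d1 d1)).
have d3 : is_derive x 1 branch_sin (- (p.[x] * W.[x]) / (q.[x] ^+ 3 * branch_sin x)).
  have pos' : 0 < 1 + -1 * (p.[x] / q.[x] * (p.[x] / q.[x])) by rewrite mulN1r.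
  have d4 := @is_derive1_comp R Num.sqrt _ x _ _ (is_derive1_sqrt pos') d2.
  apply: (near_eq_is_derive _ (is_derive_eq (is_derive_mul (dC sg) d4) _)).
    by near=> y; rewrite /branch_sin /= mulN1r.
  have -> : branch_sin x = sg^-1 * Num.sqrt (1 + -1 * (p.[x] / q.[x] * (p.[x] / q.[x]))).
    rewrite /branch_sin mulN1r; congr (_ * _); apply: (mulfI sg0).
    by rewrite divff // -expr2.
  have r0 : Num.sqrt (1 + -1 * (p.[x] / q.[x] * (p.[x] / q.[x]))) != 0.
    by rewrite gt_eqF // sqrtr_gt0.
  rewrite /= wronskE.
  move: (Num.sqrt _) r0 => r r0. by field; rewrite q0 r0 sg0.
have d5 := is_derive_mul (is_derive_mul d3 (is_derive_add dx
  (is_derive_mul (dC (-1)) (is_derive_div W0 (is_derive_mul dp dq) dW)))) (dC 2^-1).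
apply: (near_eq_is_derive _ (is_derive_eq d5 _)).
  by near=> y; rewrite /branch_im /=; ring.
(* The identity holds modulo the relation between the sine and the cosine:
   one occurrence of the sine is replaced to make it a rational identity. *)
have sE : branch_sin x = (1 - (p.[x] / q.[x]) ^+ 2) / branch_sin x.
  by rewrite -s2 expr2 mulfK.
rewrite [X in X * (1 + _)]sE.
rewrite speedE /=.
move: (branch_sin x) s0 (W^`().[x]) W0 => s s0 w1; rewrite wronskE => W0.
field.
by rewrite q0 W0 s0.
Unshelve. all: by end_near. Qed.

End RationalBranch.

Section CountableBranch.
Variables (R : realType) (p q : {poly R}) (sg : R).
Hypothesis sg2 : sg ^+ 2 = 1.
Local Notation W := (wronsk p q).

Lemma branch_dom_near x : branch_dom p q x -> \forall y \near x, branch_dom p q y.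
Proof.
move=> [q0 W0 pos].
have cq := is_derive_continuous (is_derive_poly q x).
have cp := is_derive_continuous (is_derive_poly p x).
have cW := is_derive_continuous (is_derive_poly W x).
have nq : \forall y \near x, q.[y] != 0 by exact: (cvgr_neq0 q.[x] cq).
have nW : \forall y \near x, W.[y] != 0 by exact: (cvgr_neq0 W.[x] cW).
have np : \forall y \near x, 0 < 1 - (p.[y] / q.[y]) ^+ 2.
  have h : 1 - (p.[y] / q.[y]) ^+ 2 @[y --> x] --> 1 - (p.[x] / q.[x]) ^+ 2;
    last by exact: (cvgr_gt _ h).
  apply: cvgB; first exact: cvg_cst.
  rewrite expr2; under eq_fun do rewrite expr2.
  by apply: cvgM; apply: cvgM => //; apply: cvgV.
by near=> y; split; near: y.
Unshelve. all: by end_near. Qed.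

Variables (u v r : R).

(** The tangency polynomial vanishes at [x] when the line of parameter [x],
    for one of the two signs of [sin t], is at signed distance [rho] from the
    point [u + i v]. Up to the factor [q ^+ 2] it is the square of
    [x / 2 + rho - u * (p / q)] minus the square of [v * sin t]. *)
Definition tangency (rho : R) : {poly R} :=
  ((2^-1 *: 'X + rho%:P) * q - u *: p) ^+ 2 - v ^+ 2 *: (q ^+ 2 - p ^+ 2).

Lemma horner_tangency rho x : (tangency rho).[x] =
  ((x / 2 + rho) * q.[x] - u * p.[x]) ^+ 2 - v ^+ 2 * (q.[x] ^+ 2 - p.[x] ^+ 2).
Proof. by rewrite /tangency !hornerE [2^-1 * x]mulrC. Qed.

(* [S] collects the parameters of the points on the circle. *)
Let f x := (branch_re p q x - u) ^+ 2 + (branch_im p q sg x - v) ^+ 2 - r ^+ 2.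

Let S : set R := [set x | branch_dom p q x /\ f x = 0].

(** If the point moves and its line is not tangent to the circle, then it
    crosses the circle transversally. *)
Lemma branch_dist_isolated x : S x -> (branch_speed p q).[x] != 0 ->
  (tangency r).[x] != 0 -> (tangency (- r)).[x] != 0 ->
  \forall y \near x, S y -> y = x.
Proof.
move=> [dom fx0] M0 Tp Tn.
have dX := is_derive_branch_re dom; have dY := is_derive_branch_im sg2 dom.
have dC (c : R) := is_derive_cst c x (1 : R).
have dXu := is_derive_add dX (dC (- u)); have dYv := is_derive_add dY (dC (- v)).
have df := is_derive_add (is_derive_add (is_derive_mul dXu dXu)
  (is_derive_mul dYv dYv)) (dC (- r ^+ 2)).
have {}df : is_derive x 1 f _ := df.
set D := (_ / _) in dX dY df.
have D0 : D != 0.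
  have [q0 W0 _] := dom.
  by rewrite mulf_neq0 // invr_eq0 !mulf_neq0 ?expf_neq0 // pnatr_eq0.
have [q0 W0 _] := dom.
have s2 := branch_sin_sqr sg2 dom; have s0 := branch_sin_neq0 sg2 dom.
have XYx : branch_re p q x * (p.[x] / q.[x]) + branch_im p q sg x * branch_sin p q sg x
    = x / 2.
  have -> : branch_im p q sg x * branch_sin p q sg x =
      branch_sin p q sg x ^+ 2 * (x - p.[x] * q.[x] / W.[x]) / 2.
    by rewrite /branch_im; ring.
  by rewrite s2 /branch_re; move: W.[x] W0 => w W0; field; rewrite W0 q0.
(* [N / s] is the factor of the derivative of [f] which vanishes when the line
   is orthogonal to the radius. *)
pose c := p.[x] / q.[x]; pose s := branch_sin p q sg x.
pose X := branch_re p q x; pose Y := branch_im p q sg x.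
pose N := (X - u) * s - (Y - v) * c.
have df' : is_derive x 1 f (2 * D * N / s).
  apply: (is_derive_eq df).
  rewrite /N /c /X /Y /s /=; move: (D) (branch_sin p q sg x) s0 => D' s' s0.
  by field; rewrite s0 q0.
suff N0 : N != 0.
  have l0 : 2 * D * N / s != 0.
    apply: mulf_neq0; last by rewrite invr_eq0.
    by apply: mulf_neq0 => //; apply: mulf_neq0; rewrite ?pnatr_eq0.
  have := near_neq0 df' (or_intror l0); apply: filterS => y yx [_ fy].
  by apply/eqP; apply: contraT => /yx; rewrite fy eqxx.
apply/eqP => N0.
have s2' : s ^+ 2 = 1 - c ^+ 2 by [].
(* If [N = 0] then the distance [k] from the centre to the line is the radius,
   up to sign. *)
pose k := x / 2 - u * c - v * s.
have kE : k = (X - u) * c + (Y - v) * s by rewrite /k -XYx -/X -/Y -/c -/s; ring.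
have k2 : k ^+ 2 = r ^+ 2.
  have : k ^+ 2 + N ^+ 2 = ((X - u) ^+ 2 + (Y - v) ^+ 2) * (c ^+ 2 + s ^+ 2).
    by rewrite kE /N; ring.
  rewrite N0 s2' => H'; apply/eqP; rewrite -subr_eq0; apply/eqP.
  have := fx0; rewrite /f -/X -/Y => fx.
  have -> : k ^+ 2 = (X - u) ^+ 2 + (Y - v) ^+ 2 by move: H'; lra.
  by [].
have tE rho : (tangency rho).[x] = q.[x] ^+ 2 *
    ((k + rho + v * s) ^+ 2 - v ^+ 2 * s ^+ 2).
  rewrite horner_tangency /k s2' /c; move: (s) => s'; by field.
have := k2 => /eqP; rewrite eqf_sqr => /orP[] /eqP kr.
  by move/eqP: Tn; apply; rewrite tE kr; ring.
by move/eqP: Tp; apply; rewrite tE kr; ring.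
Qed.

Lemma countable_branch : tangency r != 0 -> tangency (- r) != 0 ->
  countable (branch_re p q @` S).
Proof.
move=> Tp Tn.
pose M := branch_speed p q.
(* The set [B] is finite. Within [A] the real part is locally constant: either
   the velocity is identically zero, or the points of [A] are isolated. *)
pose A := [set x | [/\ S x, (tangency r).[x] != 0, (tangency (- r)).[x] != 0 &
                    M = 0 \/ M.[x] != 0]].
pose B := [set x : R | root (tangency r) x] `|` [set x : R | root (tangency (- r)) x]
   `|` [set x : R | M != 0 /\ root M x].
apply: (@sub_countable _ _ _ (branch_re p q @` A `|` branch_re p q @` B)).
  apply: subset_card_le => _ [x Sx <-].
  have [Bx|nBx] := pselect (B x); first by right; exists x.
  left; exists x => //; move/not_orP: nBx => [/not_orP[/negP n1 /negP n2] n3].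
  split => //; have [->|M0] := eqVneq M 0; first by left.
  by right; apply/negP => Mx; apply: n3.
apply: countable_setU.
  apply: countable_locally_cst => x [Sx T1 T2 [M0|Mx]]; last first.
    have := branch_dist_isolated Sx Mx T1 T2.
    by apply: filterS => y h [Sy _ _ _]; rewrite h.
  have := derive0_near_cst (f := branch_re p q) (x := x).
  have [dom _] := Sx.
  move=> H; have : \forall y \near x, branch_re p q y = branch_re p q x.
    apply: H; have := branch_dom_near dom; apply: filterS => y ydom.
    have := is_derive_branch_re ydom; rewrite -/M M0 horner0 mul0r; exact.
  by apply: filterS.
have cB : countable B.
  apply: countable_setU.
    by apply: countable_setU; exact: countable_roots.
  have [M0|M0] := eqVneq M 0.
    suff -> : [set x : R | false /\ root M x] = set0 by [].
    by rewrite -subset0 => x [].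
  apply: (@sub_countable _ _ _ [set x : R | root M x]).
    by apply: subset_card_le => x [].
  exact: countable_roots.
exact: (sub_countable (card_image_le _ _)).
Qed.
End CountableBranch.

(** * Circles contained in the curve *)

(** [X + i Y] is a point of the envelope of the lines
    [Re (e^{i t} z) = - x / 2], for a differentiable branch [x] of
    [E.[x] + cos t * O.[x] = 0]. *)
Definition branch_point (R : realType) (E O : {poly R}) (X Y : R) : Prop :=
  exists (t : R) (x : R -> R) (x1 : R),
    [/\ is_derive t 1 x x1,
        \forall s \near t, E.[x s] + cos s * O.[x s] = 0,
        X = - (x t * cos t - x1 * sin t) / 2 &
        Y = (x t * sin t + x1 * cos t) / 2].

(** A point of the envelope comes from a linear factor of the greatest common
    divisor, and lies on a circle centred at 0, or it comes from the cofactors,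
    which then satisfy the equation and its derivative in [t]. *)
Lemma branch_pointP (R : realType) (p q : {poly R}) (rs : seq R) (X Y : R) :
  branch_point (p * \prod_(a <- rs) ('X - a%:P)) (q * \prod_(a <- rs) ('X - a%:P)) X Y ->
  (exists2 a, a \in rs & X ^+ 2 + Y ^+ 2 = a ^+ 2 / 4) \/
  exists t x x1 : R,
   [/\ p.[x] + cos t * q.[x] = 0,
      (p^`().[x] + cos t * q^`().[x]) * x1 = sin t * q.[x],
      X = - (x * cos t - x1 * sin t) / 2 &
      Y = (x * sin t + x1 * cos t) / 2].
Proof.
move=> [t [x [x1 [xd H XE YE]]]].
have dg := is_derive_add (is_derive_pcomp p xd)
  (is_derive_mul (is_derive_cos t) (is_derive_pcomp q xd)).
have [|[a ars [xa x10]]|[g0 g1]] := near_prod_double_zero (rs := rs) xd dg _.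
- by apply: filterS H => s <-; rewrite !hornerM; ring.
- left; exists a => //; rewrite XE YE xa x10 !mul0r subr0 addr0.
  have -> : a ^+ 2 / 4 = a ^+ 2 * (cos t ^+ 2 + sin t ^+ 2) / 4.
    by rewrite cos2Dsin2 mulr1.
  by field.
- right; exists t, (x t), x1; split => //.
  by move: g1; lra.
Qed.

(** When [p] and [q] have no common root, the points with [sin t <> 0] belong to
    the rational branches. *)
Lemma branch_point_generic (R : realType) (p q : {poly R}) (X Y t x x1 : R) :
  (forall x, root p x -> ~~ root q x) ->
  p.[x] + cos t * q.[x] = 0 ->
  (p^`().[x] + cos t * q^`().[x]) * x1 = sin t * q.[x] ->
  X = - (x * cos t - x1 * sin t) / 2 ->
  Y = (x * sin t + x1 * cos t) / 2 ->
  (root ((p + q) * (p - q)) x /\ (X = x / 2 \/ X = - x / 2)) \/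
  exists sg, [/\ sg = 1 \/ sg = -1, branch_dom p q x, X = branch_re p q x &
   Y = branch_im p q sg x].
Proof.
move=> npq F0 F1 XE YE.
have q0 : q.[x] != 0.
  apply/negP => /[dup] /eqP qx; rewrite -/(root q x); apply/negP/npq.
  by move: F0; rewrite qx mulr0 addr0 /root => ->.
have cs := cos2Dsin2 t.
have pE : p.[x] = - cos t * q.[x] by move: F0; lra.
have [s0|s0] := eqVneq (sin t) 0.
  left; have c2 : cos t ^+ 2 = 1 by move: cs; rewrite s0 expr0n addr0.
  split.
    rewrite /root !hornerE pE; apply/eqP.
    have -> : forall c y : R, (- c * y + y) * (- c * y - y) = (c ^+ 2 - 1) * y ^+ 2.
      by move=> c y; ring.
    by rewrite c2 subrr mul0r.
  move: c2 => /eqP; rewrite sqrf_eq1 XE s0 => /orP[] /eqP ->; [right|left]; by field.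
right; exists (Num.sg (sin t)).
have pq : p.[x] / q.[x] = - cos t by rewrite pE mulfK.
have s2 : 1 - (p.[x] / q.[x]) ^+ 2 = sin t ^+ 2.
  by rewrite pq sqrrN; move: cs; lra.
have sE : branch_sin p q (Num.sg (sin t)) x = sin t.
  by rewrite /branch_sin s2 sqrtr_sqr -numEsg.
have Wx : (wronsk p q).[x] * x1 = sin t * q.[x] ^+ 2.
  rewrite expr2 mulrA -F1 /wronsk !hornerE pE; ring.
have W0 : (wronsk p q).[x] != 0.
  apply/eqP => W0; move/eqP: Wx; rewrite W0 mul0r eq_sym mulf_eq0 (negbTE s0) /=.
  by rewrite sqrf_eq0 (negbTE q0).
have x1E : x1 = sin t * q.[x] ^+ 2 / (wronsk p q).[x] by rewrite -Wx mulrC mulKf.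
split.
- have [sp|sp|sp] := ltrgt0P (sin t); last by move/eqP: s0.
    by left; rewrite gtr0_sg.
  by right; rewrite ltr0_sg.
- by split => //; rewrite s2 exprn_even_gt0 //= s0.
- rewrite XE x1E /branch_re pq pE.
  have -> : q.[x] ^+ 2 - (- cos t * q.[x]) ^+ 2 = sin t ^+ 2 * q.[x] ^+ 2.
    by rewrite -[sin t ^+ 2](addKr (cos t ^+ 2)) cs; ring.
  by field.
- rewrite YE x1E /branch_im sE pE; move: (_.[x]) W0 => w W0; by field.
Qed.

(** A circle made of points of the envelope is centred at 0 and comes from a
    common root of [E] and [O]. Only the two highest coefficients of each of
    [E] and [O] matter. *)
Lemma circle_in_branches (R : realType) (E O : {poly R}) (h u v r : R) :
  (size E <= 7)%N -> (size O <= 6)%N -> E`_6 = 1 -> E`_5 = 0 -> O`_5 = 2 * h -> O`_4 = 0 ->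
  h != 0 -> 0 < r ->
  (forall X Y, (X - u) ^+ 2 + (Y - v) ^+ 2 = r ^+ 2 -> branch_point E O X Y) ->
  [/\ u = 0, v = 0 & exists a, [/\ root E a, root O a & a ^+ 2 = 4 * r ^+ 2]].
Proof.
move=> sE sO E6 E5 O5 O4 h0 r0 circ.
have E0 : E != 0 by apply/eqP => E0; move/eqP: E6; rewrite E0 coef0 eq_sym oner_eq0.
have [rs [p [q [EE OE npq]]]] := split_common_roots O E0.
apply: contrapT => nconcl.
set G := \prod_(a <- rs) _ in EE OE.
(* [cut a] vanishes at the abscissas of the common points of the given circle
   and the circle of radius [|a| / 2] centred at 0: subtracting the equations
   gives [2 * u * X + 2 * v * Y = k], from which [Y] is eliminated. It is zero
   only when the two circles are equal. *)
pose cut a : {poly R} := let k := u ^+ 2 + v ^+ 2 + a ^+ 2 / 4 - r ^+ 2 in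
  (4 * (u ^+ 2 + v ^+ 2)) *: 'X^2 - (4 * u * k) *: 'X + (k ^+ 2 - v ^+ 2 * a ^+ 2)%:P.
have cutE a X Y : (X - u) ^+ 2 + (Y - v) ^+ 2 = r ^+ 2 -> X ^+ 2 + Y ^+ 2 = a ^+ 2 / 4 ->
    root (cut a) X.
  move=> h1 h2; apply/eqP.
  rewrite /cut !(hornerD, hornerN, hornerZ, hornerXn, hornerX, hornerC).
  have kE : u ^+ 2 + v ^+ 2 + a ^+ 2 / 4 - r ^+ 2 = 2 * u * X + 2 * v * Y.
    by rewrite -h1 -h2; ring.
  have aE : a ^+ 2 = 4 * (X ^+ 2 + Y ^+ 2) by rewrite h2; field.
  by rewrite kE aE; ring.
have cut0 a : a \in rs -> cut a != 0.
  move=> ars; apply/eqP => ca.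
  have c2 : 4 * (u ^+ 2 + v ^+ 2) = 0.
    have := congr1 (fun P : {poly R} => P`_2) ca.
    by rewrite /cut coefD coefB !coefZ coefXn coefX coefC coef0 /= mulr1 mulr0 subr0 addr0.
  have u0 : u = 0 by apply/eqP; rewrite -sqrf_eq0; apply/eqP; nra.
  have v0 : v = 0 by apply/eqP; rewrite -sqrf_eq0; apply/eqP; nra.
  have := congr1 (fun P : {poly R} => P`_0) ca.
  rewrite /cut coefD coefB !coefZ coefXn coefX coefC coef0 /= !mulr0 subr0 add0r.
  rewrite u0 v0 expr0n !mul0r subr0 !add0r => /eqP; rewrite sqrf_eq0 subr_eq0 => /eqP ar.
  apply: nconcl; split=> //; exists a.
  have Ga : root G a by rewrite /G root_prod_XsubC.
  by rewrite EE OE !rootM Ga !orbT; split => //; rewrite -ar; field.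
have pq0 : (p + q) * (p - q) != 0.
  rewrite mulf_neq0 //; apply/eqP => pq0.
    have : (E + O)`_6 = 0 by rewrite EE OE -mulrDl pq0 mul0r coef0.
    by rewrite coefD E6 nth_default // addr0 => /eqP; rewrite oner_eq0.
  have : (E - O)`_6 = 0 by rewrite EE OE -mulrBl pq0 mul0r coef0.
  by rewrite coefB E6 nth_default // subr0 => /eqP; rewrite oner_eq0.
have tang0 rho : rho ^+ 2 = r ^+ 2 -> tangency p q u v rho != 0.
  move=> rho2; apply/eqP => T0.
  have TG : ((2^-1 *: 'X + rho%:P) * O - u *: E) ^+ 2 =
      v ^+ 2 *: (O ^+ 2 - E ^+ 2).
    apply/eqP; rewrite -subr_eq0; apply/eqP.
    transitivity (tangency p q u v rho * G ^+ 2); last by rewrite T0 mul0r.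
    by rewrite /tangency EE OE -!mul_polyC; ring.
  set P := _ - u *: E in TG.
  have sP : (size P <= 7)%N.
    rewrite (leq_trans (size_polyD _ _)) // size_polyN geq_max.
    rewrite (leq_trans (size_scale_leq _ _) sE) andbT.
    rewrite (leq_trans (size_polyMleq _ _)) //.
    have : (size (2^-1 *: 'X + rho%:P)%R <= 2)%N.
      rewrite (leq_trans (size_polyD _ _)) // geq_max.
      rewrite (leq_trans (size_scale_leq _ _)) ?size_polyX //=.
      exact: leq_trans (size_polyC_leq1 _) _.
    by move: (size _) sO => i; move: (size _) => j; lia.
  have Pi i : P`_i.+1 = O`_i / 2 + rho * O`_i.+1 - u * E`_i.+1.
    by rewrite /P coefB mulrDl coefD -scalerAl !coefZ coefXM coefCM /= mulrC.
  have O6 : O`_6 = 0 by rewrite nth_default.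
  (* The coefficient of degree 12 is the sum of squares below, so the centre is
     [h]; then the coefficient of degree 5 of [P = 0] forces [rho = 0]. *)
  have TG12 := congr1 (fun P : {poly R} => P`_(6 + 6)) TG.
  have uv : (h - u) ^+ 2 + v ^+ 2 = 0.
    move: TG12; rewrite coefZ coefB !expr2 !coefM_top // ?(leq_trans sO) //.
    rewrite Pi O5 O6 E6 (_ : 2 * h / 2 + rho * 0 - u * 1 = h - u); last by field.
    by move=> ->; ring.
  move/eqP: uv; rewrite paddr_eq0 ?sqr_ge0 // !sqrf_eq0 subr_eq0.
  move=> /andP[/eqP hu /eqP v0].
  move/eqP: TG; rewrite v0 expr0n scale0r sqrf_eq0 => /eqP P0.
  have := Pi 4; rewrite P0 coef0 O4 O5 E5 mul0r mulr0 add0r subr0.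
  move=> /esym/eqP; rewrite !mulf_eq0 pnatr_eq0 (negbTE h0) !orbF => /eqP rho0.
  by move: rho2; rewrite rho0 expr0n => /esym/eqP; rewrite sqrf_eq0 (gt_eqF r0).
pose S sg := [set x | branch_dom p q x /\
  (branch_re p q x - u) ^+ 2 + (branch_im p q sg x - v) ^+ 2 - r ^+ 2 = 0].
(* [Z] collects the parameters of the points with [sin t = 0]. *)
pose Z := [set x : R | root ((p + q) * (p - q)) x].
apply: (@uncountable_itv R (u - r) (u + r)); first by lra.
apply: (@sub_countable _ _ _ (([set x | root (\prod_(a <- rs) cut a) x] `|`
   ((fun x : R => x / 2) @` Z `|` (fun x : R => - x / 2) @` Z)) `|`
   (branch_re p q @` S 1 `|` branch_re p q @` S (-1)))).
  apply: subset_card_le => X /=; rewrite in_itv /= => /andP[X1 X2].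
  have XY : (X - u) ^+ 2 + (v + Num.sqrt (r ^+ 2 - (X - u) ^+ 2) - v) ^+ 2 = r ^+ 2.
    rewrite [v + _]addrC addrK sqr_sqrtr; first by ring.
    by nra.
  have := circ _ _ XY; move: XY; move: (v + _) => Y XY.
  rewrite EE OE => /branch_pointP[[a ars aXY]|[t [x [x1 [F0 F1 XE YE]]]]].
    left; left; rewrite /root (big_rem a) //= hornerM.
    by have /rootP -> := cutE _ _ _ XY aXY; rewrite mul0r.
  have [[xZ [XE'|XE']]|[sg [sg1 dom XE' YE']]] := branch_point_generic npq F0 F1 XE YE.
  - by left; right; left; exists x.
  - by left; right; right; exists x.
  - right; case: sg1 => sgE; [left|right]; exists x => //; split=> //;
      by rewrite -sgE -XE' -YE' XY subrr.
have cim (f : R -> R) A : countable A -> countable (f @` A).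
  exact/sub_countable/card_image_le.
apply: countable_setU; last first.
  apply: countable_setU; apply: countable_branch; rewrite ?tang0 ?sqrrN ?expr1n //.
apply: countable_setU; last first.
  by apply: countable_setU; apply: cim; exact: countable_roots.
apply: countable_roots.
by rewrite prodf_seq_neq0; apply/allP => a /cut0.
Qed.

(** * The Kippenhahn polynomial *)

(** The [n] x [n] matrix with a given sequence of rows, padded with zeros. *)
Definition mx_of_rows (R : comNzRingType) n (s : seq (seq R)) : 'M[R]_n :=
  \matrix_(i < n, j < n) nth 0 (nth [::] s i) j.

(** The sequence [s] without its item of index [i]. *)
Definition skip_nth {T} i (s : seq T) := take i s ++ drop i.+1 s.

(** The determinant computed by expansion along the first row. It reduces to a
    ring expression when the entries are explicit. *)
Fixpoint laplace_det (R : comNzRingType) n (s : seq (seq R)) : R :=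
  if n is n'.+1 then
    foldr +%R 0 [seq nth 0 (head [::] s) j *
      ((-1) ^+ j * laplace_det n' (map (skip_nth j) (behead s))) | j <- iota 0 n]
  else 1.

Lemma nth_skip_nth {T} (x : T) i s l : nth x (skip_nth i s) l = nth x s (bump i l).
Proof.
rewrite /skip_nth nth_cat size_take nth_drop /bump.
case: (ltnP i (size s)) => hi; case: (leqP i l) => hl.
- by rewrite addSn subnKC.
- by rewrite nth_take.
- rewrite [(l < size s)%N]ltnNge (leq_trans hi hl) /= !nth_default //;
    first exact: leq_trans hi (leqW hl).
  by rewrite (leq_trans hi) // leqW // leq_addr.
- rewrite add0n take_oversize //; case: ltnP => // hl'.
  rewrite !nth_default //; by rewrite (leq_trans hi) // leqW // leq_addr.
Qed.

Lemma det_mx_of_rows (R : comNzRingType) n (s : seq (seq R)) : size s = n ->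
  \det (mx_of_rows n s) = laplace_det n s.
Proof.
elim: n s => [|n IH] s; first by rewrite det_mx00.
case: s => // r s [sz].
rewrite (expand_det_row _ ord0).
rewrite -[RHS]/(foldr +%R 0 [seq nth 0 r j *
  ((-1) ^+ j * laplace_det n (map (skip_nth j) s)) | j <- iota 0 n.+1]).
rewrite foldrE big_map.
have -> : iota 0 n.+1 = index_iota 0 n.+1 by [].
rewrite big_mkord; apply: eq_bigr => j _.
rewrite !mxE /= /cofactor add0n; congr (_ * (_ * _)).
rewrite -IH ?size_map //; congr (\det _).
apply/matrixP => k l; rewrite !mxE /= (nth_map [::]) ?sz //.
by rewrite nth_skip_nth.
Qed.

Lemma det_bordered (R : comNzRingType) (b c d e f g y x w v : R) :
  \det (mx_of_rows 6 [:: [:: x; 0; 0; w; 0; 0];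
                  [:: 0; x; 0; 0; w*b; 0];
                  [:: 0; 0; x; 0; w*c; w*e];
                  [:: v; 0; 0; x; w*d; w*f];
                  [:: 0; v*b; v*c; v*d; x; w*g];
                  [:: 0; 0; v*e; v*f; v*g; y]]) =
 x^+5*y - x^+3*y*(w*v)*(1+b^+2+c^+2+d^+2) + x*y*(w*v)^+2*(b^+2+c^+2)
 - x^+4*(w*v)*(e^+2+f^+2+g^+2)
 + (w*v)^+2*x^+2*(e^+2*(1+b^+2+d^+2)+f^+2*(b^+2+c^+2)+g^+2-2*c*d*e*f)
 - (w*v)^+3*e^+2*b^+2
 + (w*v)*(w+v)*x^+3*(d*g*f+c*g*e) - (w*v)^+2*(w+v)*x*c*g*e.
Proof. by rewrite det_mx_of_rows // /laplace_det /skip_nth /=; ring. Qed.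

Lemma cis_mul_conj (R : realType) (t : R) : cis t * conjc (cis t) = 1.
Proof.
apply/eqP; rewrite eq_complex /=; apply/andP; split; apply/eqP; last by ring.
by rewrite -(cos2Dsin2 t); ring.
Qed.

Lemma cis_add_conj (R : realType) (t : R) : cis t + conjc (cis t) = (2 * cos t)%:C.
Proof.
by apply/eqP; rewrite eq_complex /=; apply/andP; split; apply/eqP; ring.
Qed.

Lemma mxRe_mxA (R : realType) (b c d e f g h t l : R) :
  let w := cis t in let v := conjc (cis t) in let x := (- 2 * l)%:C in
  2 *: (mxRe (cis t *: mxA b c d e f g h) - (l%:C)%:M) =
  mx_of_rows 6 [:: [:: x; 0; 0; w; 0; 0];
            [:: 0; x; 0; 0; w*b%:C; 0];
            [:: 0; 0; x; 0; w*c%:C; w*e%:C];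
            [:: v; 0; 0; x; w*d%:C; w*f%:C];
            [:: 0; v*b%:C; v*c%:C; v*d%:C; x; w*g%:C];
            [:: 0; 0; v*e%:C; v*f%:C; v*g%:C; (2 * h * cos t - 2 * l)%:C]].
Proof.
move=> w v x.
have two0 : (2 : R[i]) != 0 by rewrite pnatr_eq0.
apply/matrixP => i j; rewrite !mxE mulrBr mulrA divff // mul1r.
have cj (y : R) : conjc (cis t * y%:C) = v * y%:C.
  by rewrite /v; apply/eqP; rewrite eq_complex /=; apply/andP; split; apply/eqP; ring.
rewrite cj -/w.
have wv : w + v = 2 * (cos t)%:C by rewrite cis_add_conj rmorphM rmorph_nat.
case: i => [[|[|[|[|[|[|//]]]]]] hi]; case: j => [[|[|[|[|[|[|//]]]]]] hj] /=;
  rewrite /x ?rmorph0 ?rmorph1 ?rmorphM ?rmorphN ?rmorph_nat ?rmorphB; try ring.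
rewrite !rmorphM /= !rmorph_nat mulrAC -wv; ring.
Qed.

(** With [w] and [v] inverse to each other, as [e^{i theta}] and its conjugate
    are, the determinant is in the image of [phi]. *)
Lemma det_bordered_rmorph (S R : comNzRingType) (phi : {rmorphism S -> R})
    (b c d e f g y x s : S) (w v : R) : w * v = 1 -> w + v = phi s ->
  \det (mx_of_rows 6 [:: [:: phi x; 0; 0; w; 0; 0];
                  [:: 0; phi x; 0; 0; w * phi b; 0];
                  [:: 0; 0; phi x; 0; w * phi c; w * phi e];
                  [:: v; 0; 0; phi x; w * phi d; w * phi f];
                  [:: 0; v * phi b; v * phi c; v * phi d; phi x; w * phi g];
                  [:: 0; 0; v * phi e; v * phi f; v * phi g; phi y]]) =
  phi (x^+5*y - x^+3*y*(1+b^+2+c^+2+d^+2) + x*y*(b^+2+c^+2)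
   - x^+4*(e^+2+f^+2+g^+2) + x^+2*(e^+2*(1+b^+2+d^+2)+f^+2*(b^+2+c^+2)+g^+2-2*c*d*e*f)
   - e^+2*b^+2 + s*x^+3*(d*g*f+c*g*e) - s*x*c*g*e).
Proof. by move=> wv1 wvs; rewrite det_bordered wv1 wvs; ring. Qed.

(** The polynomial before the relations between the entries are used. *)
Lemma kippenhahn_polyE (R : realType) (b c d e f g h l t : R) :
  let x := - 2 * l in let y := 2 * h * cos t + x in
  2 ^+ 6 * kippenhahn_poly (mxA b c d e f g h) l t =
  (x^+5*y - x^+3*y*(1+b^+2+c^+2+d^+2) + x*y*(b^+2+c^+2)
   - x^+4*(e^+2+f^+2+g^+2) + x^+2*(e^+2*(1+b^+2+d^+2)+f^+2*(b^+2+c^+2)+g^+2-2*c*d*e*f)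
   - e^+2*b^+2 + 2*cos t*x^+3*(d*g*f+c*g*e) - 2*cos t*x*c*g*e)%:C.
Proof.
move=> x y; rewrite /kippenhahn_poly -detZ mxRe_mxA.
rewrite (det_bordered_rmorph (phi := real_complex R) _ _ _ _ _ _ _ _
  (cis_mul_conj t) (cis_add_conj t)).
by rewrite /y [_ + x](_ : _ = 2 * h * cos t - 2 * l) // /x; ring.
Qed.

(** The part without [cos theta] of [2 ^+ 6] times the Kippenhahn polynomial,
    as a polynomial in [x = - 2 * lambda]. *)
Definition even_part (R : realType) (b d e h : R) : {poly R} :=
  Poly [:: - (e ^+ 2 * b ^+ 2); 0; 2 - h ^+ 2 - d ^+ 2 + e ^+ 2; 0;
           - (3 - h ^+ 2); 0; 1].

(** The coefficient of [cos theta] in the same polynomial. *)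
Definition odd_part (R : realType) (d f g h : R) : {poly R} :=
  Poly [:: 0; 2 * h * (1 - d ^+ 2); 0; 2 * (d * g * f) - 4 * h; 0; 2 * h].

Lemma horner_even_part (R : realType) (b d e h x : R) :
  (even_part b d e h).[x] = x ^+ 6 - (3 - h ^+ 2) * x ^+ 4 +
    (2 - h ^+ 2 - d ^+ 2 + e ^+ 2) * x ^+ 2 - e ^+ 2 * b ^+ 2.
Proof. by rewrite horner_Poly /=; ring. Qed.

Lemma horner_odd_part (R : realType) (d f g h x : R) :
  (odd_part d f g h).[x] =
    2 * x * (h * (x ^+ 4 - 2 * x ^+ 2 + 1 - d ^+ 2) + d * g * f * x ^+ 2).
Proof. by rewrite horner_Poly /=; ring. Qed.

Section KippenhahnPolynomial.
Variables (R : realType) (b c d e f g h : R).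
Hypotheses (hbcd : b ^+ 2 + c ^+ 2 + d ^+ 2 = 1)
  (hefgh : e ^+ 2 + f ^+ 2 + g ^+ 2 + h ^+ 2 = 1)
  (hcedf : c * e + d * f = 0) (hcg : c * g = 0).

Lemma kippenhahn_poly_eq0 (l t : R) :
  kippenhahn_poly (mxA b c d e f g h) l t = 0 <->
  (even_part b d e h).[- 2 * l] + cos t * (odd_part d f g h).[- 2 * l] = 0.
Proof.
have two0 : (2 : R[i]) ^+ 6 != 0 by rewrite expf_neq0 // pnatr_eq0.
suff H : 2 ^+ 6 * kippenhahn_poly (mxA b c d e f g h) l t =
    ((even_part b d e h).[- 2 * l] + cos t * (odd_part d f g h).[- 2 * l])%:C.
  split=> [k0|k0]; first by move: H; rewrite k0 mulr0 => -[].
  by apply: (mulfI two0); rewrite H k0 mulr0.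
rewrite kippenhahn_polyE horner_even_part horner_odd_part; congr (_%:C).
move: (- 2 * l) (cos t) => x C.
have b2 : b ^+ 2 = 1 - c ^+ 2 - d ^+ 2 by move: hbcd; lra.
have h2 : h ^+ 2 = 1 - e ^+ 2 - f ^+ 2 - g ^+ 2 by move: hefgh; lra.
have ce2 : c ^+ 2 * e ^+ 2 = d ^+ 2 * f ^+ 2.
  have -> : c ^+ 2 * e ^+ 2 = (c * e) ^+ 2 by ring.
  have -> : c * e = - (d * f) by move: hcedf; lra.
  by ring.
have cdef : c * d * e * f = - (d ^+ 2 * f ^+ 2).
  have -> : c * d * e * f = (c * e) * (d * f) by ring.
  have -> : c * e = - (d * f) by move: hcedf; lra.
  by ring.
transitivity (x^+5*(2*h*C+x) - x^+3*(2*h*C+x)*(1+(b^+2+c^+2+d^+2)) + x*(2*h*C+x)*(b^+2+c^+2)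
   - x^+4*(e^+2+f^+2+g^+2) + x^+2*(e^+2*(2-c^+2)+f^+2*(1-d^+2)+g^+2-2*(c*d*e*f))
   - e^+2*b^+2 + 2*C*x^+3*(d*g*f+c*g*e) - 2*C*x*(c*g)*e).
  by rewrite b2; ring.
rewrite hbcd hcg cdef.
rewrite (_ : b ^+ 2 + c ^+ 2 = 1 - d ^+ 2); last by rewrite b2; ring.
rewrite (_ : e ^+ 2 + f ^+ 2 + g ^+ 2 = 1 - h ^+ 2); last by rewrite h2; ring.
rewrite (_ : _ - 2 * - _ = 1 - h ^+ 2 + e ^+ 2); first by ring.
by rewrite h2 mulrBr [e ^+ 2 * c ^+ 2]mulrC ce2; ring.
Qed.

Let A := mxA b c d e f g h.

(** By the two conditions of the envelope, [lambda = X cos t - Y sin t] and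
    [lambda' = - (X sin t + Y cos t)]. *)
Lemma kippenhahn_curve_branch (z : R[i]) : kippenhahn_curve A z ->
  branch_point (even_part b d e h) (odd_part d f g h) (complex.Re z) (complex.Im z).
Proof.
case: z => X Y [t [l [_ H [s _ sE] hd]]].
have [_ dl] := nbhs_singleton H.
have /derivableP dl' := dl; set l1 := 'D_1 l t in dl'.
have d2 := is_derive_add (is_derive_add
    (is_derive_mul (is_derive_cos t) (is_derive_cst X t (1 : R)))
    (is_derive_mul (is_derive_cst (-1 : R) t (1 : R))
       (is_derive_mul (is_derive_sin t) (is_derive_cst Y t (1 : R)))))
  (is_derive_mul (is_derive_cst (-1 : R) t (1 : R)) dl').
have l1E : l1 = - (X * sin t + Y * cos t).
  have [_ hd'] := hd; have [_ d2'] := d2.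
  move: d2'; set F := fun _ => _.
  have -> : F = (fun t0 : R => complex.Re (cis t0 * (X +i* Y)) - l t0).
    by apply/funext => y; rewrite /F /=; ring.
  by rewrite hd' /=; lra.
have cs := cos2Dsin2 t.
have lE : l t = X * cos t - Y * sin t.
  move: sE; rewrite /cis cosN sinN /= => -[<- <-].
  by rewrite -[LHS]mulr1 -cs; ring.
have dx := is_derive_mul (is_derive_cst (- 2 : R) t (1 : R)) dl'.
exists t, (fun y => - 2 * l y), (- 2 * l1); split.
- by apply: (is_derive_eq dx); rewrite mul0r add0r.
- by apply: filterS H => y [/kippenhahn_poly_eq0].
- rewrite l1E lE /=; transitivity (X * (cos t ^+ 2 + sin t ^+ 2)); last by field.
  by rewrite cs mulr1.
- rewrite l1E lE /=; transitivity (Y * (cos t ^+ 2 + sin t ^+ 2)); last by field.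
  by rewrite cs mulr1.
Qed.

Lemma branch_kippenhahn_curve (t X Y : R) (l : R -> R) :
  - pi < t <= pi ->
  (\forall s \near t, (even_part b d e h).[- 2 * l s] +
     cos s * (odd_part d f g h).[- 2 * l s] = 0 /\ derivable l s 1) ->
  l t = X * cos t - Y * sin t ->
  is_derive t 1 l (- (X * sin t + Y * cos t)) ->
  kippenhahn_curve A (X +i* Y).
Proof.
move=> tpi H lE dl; have cs := cos2Dsin2 t; exists t, l; split => //.
- by apply: filterS H => s [/kippenhahn_poly_eq0].
- exists (X * sin t + Y * cos t) => //; rewrite /cis cosN sinN lE.
  by apply/eqP; rewrite eq_complex /=; apply/andP; split; apply/eqP;
    rewrite -[RHS]mulr1 -cs; ring.
- have d2 := is_derive_add (is_derive_add
    (is_derive_mul (is_derive_cos t) (is_derive_cst X t (1 : R)))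
    (is_derive_mul (is_derive_cst (-1 : R) t (1 : R))
       (is_derive_mul (is_derive_sin t) (is_derive_cst Y t (1 : R)))))
    (is_derive_mul (is_derive_cst (-1 : R) t (1 : R)) dl).
  set F := fun _ => _; set G := fun _ => _ in d2.
  have -> : F = G by apply/funext => y; rewrite /F /G /=; ring.
  by apply: (is_derive_eq d2) => /=; ring.
Qed.
End KippenhahnPolynomial.

(** * Coordinates in the plane *)

Lemma normc_sqrt (R : realType) (X Y : R) : `|X +i* Y| = (Num.sqrt (X ^+ 2 + Y ^+ 2))%:C.
Proof. by rewrite normc_def. Qed.

Lemma circleP (R : realType) (a z : R[i]) (r : R) : 0 <= r ->
  circle a r z <->
  (complex.Re z - complex.Re a) ^+ 2 + (complex.Im z - complex.Im a) ^+ 2 = r ^+ 2.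
Proof.
move=> r0; case: a z => [u v] [X Y].
rewrite /circle /= -[_ - _]/((X - u) +i* (Y - v)) normc_sqrt.
split=> [[<-]|->]; first by rewrite sqr_sqrtr // addr_ge0 ?sqr_ge0.
by rewrite sqrtr_sqr ger0_norm.
Qed.

Lemma polar_angle (R : realType) (C S : R) : C ^+ 2 + S ^+ 2 = 1 ->
  exists t : R, [/\ - pi < t <= pi, cos t = C & sin t = S].
Proof.
move=> CS; have C1 : -1 <= C <= 1 by apply/andP; split; nra.
have pi0 := pi_gt0 R.
have [t0 tpi] : 0 <= acos C /\ acos C <= pi by rewrite acos_ge0 ?acos_lepi.
have sE : sin (acos C) = `|S|.
  by rewrite sin_acos // -sqrtr_sqr; congr Num.sqrt; lra.
have cE : cos (acos C) = C by rewrite acosK // in_itv.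
have [S0|S0] := leP 0 S.
  exists (acos C); rewrite cE sE ger0_norm //; split => //.
  by apply/andP; split; lra.
exists (- acos C); rewrite cosN sinN cE sE ltr0_norm // opprK; split => //.
have : acos C != pi.
  by apply/eqP => aC; move: sE; rewrite aC sinpi => /esym/eqP; rewrite normr_eq0 lt_eqF.
by rewrite neq_lt => /orP[] h; apply/andP; split; lra.
Qed.

(** * Common roots force the splitting conditions *)

Section CommonRoots.
Variables (R : realType) (b c d e f g h : R).
Hypotheses
  (hbcd : b ^+ 2 + c ^+ 2 + d ^+ 2 = 1)
  (hefgh : e ^+ 2 + f ^+ 2 + g ^+ 2 + h ^+ 2 = 1)
  (hcedf : c * e + d * f = 0)
  (hce : e = 0 -> c = 0)
  (hh0 : h <> 0) (hcg : c * g = 0).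

(** Here [s] is the square of a common root of the even and the odd part. *)
Lemma common_root_case (s : R) : 0 < s -> s != 1 ->
  s ^+ 3 - (3 - h ^+ 2) * s ^+ 2 + (2 - h ^+ 2 - d ^+ 2 + e ^+ 2) * s - e ^+ 2 * b ^+ 2 = 0 ->
  h * (s ^+ 2 - 2 * s + 1 - d ^+ 2) + d * g * f * s = 0 ->
  [/\ d <> 0, c = 0 & g = 0].
Proof.
move=> s0 s1 Es Os.
have dfg : d * g * f = 0.
  have -> : d * g * f = (c * e + d * f) * g - c * g * e by ring.
  by rewrite hcedf hcg !mul0r subrr.
have sd : s ^+ 2 - 2 * s + 1 - d ^+ 2 = 0.
  move/eqP: Os; rewrite dfg mul0r addr0 mulf_eq0 => /orP[/eqP //|/eqP //].
have d0 : d <> 0.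
  move=> d0; move/eqP: s1; apply; apply/eqP; rewrite -subr_eq0 -sqrf_eq0; apply/eqP.
  by rewrite -[RHS]sd d0; ring.
(* Reducing the even part modulo [s ^+ 2 - 2 * s + 1 - d ^+ 2] makes it linear
   in [s]. *)
have key : - (f ^+ 2 + g ^+ 2) * s + (e ^+ 2 + f ^+ 2 + g ^+ 2) * (1 - d ^+ 2)
    - e ^+ 2 * b ^+ 2 = 0.
  have h2 : h ^+ 2 = 1 - e ^+ 2 - f ^+ 2 - g ^+ 2 by move: hefgh; lra.
  transitivity (s ^+ 3 - (3 - h ^+ 2) * s ^+ 2 + (2 - h ^+ 2 - d ^+ 2 + e ^+ 2) * s
     - e ^+ 2 * b ^+ 2 - (s - (1 - h ^+ 2)) * (s ^+ 2 - 2 * s + 1 - d ^+ 2)).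
    by rewrite h2; ring.
  by rewrite Es sd mulr0 subrr.
have [c0|c0] := eqVneq c 0; last first.
  have g0 : g = 0 by move/eqP: hcg; rewrite mulf_eq0 (negbTE c0) => /eqP.
  have df : d * f = - (c * e) by move: hcedf; lra.
  have f0 : f ^+ 2 * (1 - s) = 0.
    rewrite -[RHS]key g0 (_ : b ^+ 2 = 1 - c ^+ 2 - d ^+ 2); last by move: hbcd; lra.
    have : d ^+ 2 * f ^+ 2 = c ^+ 2 * e ^+ 2 by rewrite -!exprMn df sqrrN.
    by lra.
  have : c * e = 0.
    move/eqP: f0; rewrite mulf_eq0 sqrf_eq0 subr_eq0 [1 == s]eq_sym (negbTE s1) orbF.
    by move=> /eqP f0; move: df; rewrite f0 mulr0; lra.
  move/eqP; rewrite mulf_eq0 (negbTE c0) => /eqP /hce c0'.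
  by rewrite c0' eqxx in c0.
split => //; apply/eqP; apply: contraT => g0; exfalso.
have b2 : b ^+ 2 = 1 - d ^+ 2 by move: hbcd; rewrite c0; lra.
have : (f ^+ 2 + g ^+ 2) * (1 - d ^+ 2 - s) = 0 by rewrite -[RHS]key b2; ring.
have g2 : 0 < g ^+ 2 by rewrite exprn_even_gt0 //= g0.
have fg : f ^+ 2 + g ^+ 2 != 0 by rewrite gt_eqF // ltr_wpDl ?sqr_ge0.
move/eqP; rewrite mulf_eq0 (negbTE fg) subr_eq0 => /eqP sE.
have : d ^+ 2 * (d ^+ 2 - 1) = 0 by rewrite -[RHS]sd -sE; ring.
move/eqP; rewrite mulf_eq0 sqrf_eq0 => /orP[/eqP //|/eqP d1].
by move: s0; rewrite -sE; lra.
Qed.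

Lemma circle_case (a : R[i]) (r : R) : 0 < r ->
  circle a r `<=` kippenhahn_curve (mxA b c d e f g h) ->
  circle a r <> circle (0 : R[i]) (1 / 2 : R) ->
  [/\ d <> 0, c = 0 & g = 0].
Proof.
case: a => u v r0 sub ne.
have [|||||||||u0 v0 [a [Ea Oa a2]]] := @circle_in_branches R (even_part b d e h)
  (odd_part d f g h) h u v r; rewrite ?coef_Poly ?size_Poly //; first exact/eqP.
  move=> X Y XY; apply: (kippenhahn_curve_branch hbcd hefgh hcedf hcg (z := X +i* Y)).
  by apply: sub; apply/circleP => //; exact: ltW.
have a0 : a != 0 by rewrite -sqrf_eq0 a2 gt_eqF // mulr_gt0 // exprn_gt0.
move/rootP: Ea; rewrite horner_even_part => Ea.
move/rootP: Oa; rewrite horner_odd_part => /eqP.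
rewrite !mulf_eq0 pnatr_eq0 (negbTE a0) /= => /eqP Oa.
apply: (@common_root_case (a ^+ 2)).
- by rewrite a2 mulr_gt0 // exprn_gt0.
- apply/eqP => a1; apply: ne; rewrite u0 v0; congr circle.
  by have : (r - 1 / 2) * (r + 1 / 2) = 0; [nra|move/eqP; rewrite mulf_eq0 => /orP[]/eqP; lra].
- by rewrite -[RHS]Ea -!exprM.
- by rewrite -[RHS]Oa -!exprM; ring.
Qed.
End CommonRoots.

(** * The curve in the splitting case *)

(** The case [c = f = g = 0], with [b ^+ 2] and [e ^+ 2] eliminated. *)
Section SplitCase.
Variables (R : realType) (b d e h : R).
Hypotheses (hd : 0 <= d) (hh : 0 < h) (hb2 : b ^+ 2 = 1 - d ^+ 2) (he2 : e ^+ 2 = 1 - h ^+ 2).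
Local Notation E := (even_part b d e h).
Local Notation O := (odd_part d 0 0 h).
Local Notation k := (1 - h ^+ 2).

Let d1 : d <= 1.
Proof. by have := sqr_ge0 b; rewrite hb2; nra. Qed.
Let h1 : h <= 1.
Proof. by have := sqr_ge0 e; rewrite he2; nra. Qed.

Let a1 := Num.sqrt (1 - d).
Let a2 := Num.sqrt (1 + d).
Let a1E : a1 ^+ 2 = 1 - d.
Proof. by rewrite sqr_sqrtr // subr_ge0. Qed.
Let a2E : a2 ^+ 2 = 1 + d.
Proof. by rewrite sqr_sqrtr // addr_ge0. Qed.
Let rs := [:: a1; - a1; a2; - a2].

Lemma split_parts (x C : R) :
  E.[x] + C * O.[x] =
  (x ^+ 2 - a1 ^+ 2) * (x ^+ 2 - a2 ^+ 2) * (x ^+ 2 + 2 * h * C * x - k).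
Proof. by rewrite a1E a2E horner_even_part horner_odd_part hb2 he2; ring. Qed.

(** The Cartesian equation of the ellipse. *)
Lemma ellipse_eqP (X Y : R) : h < 1 ->
  ellipse (0 : R[i]) h%:C 1 (X +i* Y) <-> 4 * Y ^+ 2 = k * (1 - (2 * X - h) ^+ 2).
Proof.
move=> hlt; rewrite /ellipse sub0r normrN ger0_norm ?lecR ?(ltW hh) //.
have -> : (h%:C == 1%:C :> R[i]) = false.
  by apply/negbTE/eqP => -[] hE; move: hlt; rewrite hE ltxx.
rewrite /= subr0 -[_ - _%:C]/((X - h) +i* (Y - 0)) subr0 !normc_sqrt -rmorphD /=.
set P := X ^+ 2 + Y ^+ 2; set Q := _ + Y ^+ 2.
have P0 : 0 <= P by rewrite addr_ge0 ?sqr_ge0.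
have Q0 : 0 <= Q by rewrite addr_ge0 ?sqr_ge0.
have k0 : 0 < k by rewrite subr_gt0 expr_lt1 // ltW.
split=> [[PQ]|YE].
  have QE : Num.sqrt Q = 1 - Num.sqrt P by lra.
  have : Num.sqrt Q ^+ 2 = 1 - 2 * Num.sqrt P + Num.sqrt P ^+ 2 by rewrite QE; ring.
  rewrite !sqr_sqrtr // => QP.
  have sP : Num.sqrt P = (1 - h ^+ 2 + 2 * h * X) / 2.
    by move: QP; rewrite /P /Q => QP; lra.
  have := sqr_sqrtr P0; rewrite sP /P => PE.
  have -> : Y ^+ 2 = ((1 - h ^+ 2 + 2 * h * X) / 2) ^+ 2 - X ^+ 2 by rewrite PE; ring.
  by field.
have PE : P = ((1 + h * (2 * X - h)) / 2) ^+ 2.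
  rewrite /P (_ : Y ^+ 2 = k * (1 - (2 * X - h) ^+ 2) / 4); first by field.
  by rewrite -YE; field.
have QE : Q = ((1 - h * (2 * X - h)) / 2) ^+ 2.
  rewrite /Q (_ : Y ^+ 2 = k * (1 - (2 * X - h) ^+ 2) / 4); first by field.
  by rewrite -YE; field.
have p1 : (2 * X - h) ^+ 2 <= 1.
  by have := sqr_ge0 Y; have : 0 < k := k0; nra.
move: p1; set p := 2 * X - h in PE QE *; move=> p1.
have hp1 : (h * p) ^+ 2 <= 1 by rewrite exprMn; nra.
rewrite PE QE !sqrtr_sqr !ger0_norm; [by congr (_%:C); field|nra|nra].
Qed.

(** The points of a branch of the quadratic factor satisfy the equation of the
    ellipse: [m = x + h * C] is nonzero, [2 * X - h = - C / m] and
    [2 * Y = (1 - h ^+ 2) * S / m]. *)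
Lemma ellipse_of_branch (X Y C S x x1 : R) : h < 1 -> C ^+ 2 + S ^+ 2 = 1 ->
  x ^+ 2 + 2 * h * C * x = k -> (x + h * C) * x1 = h * S * x ->
  X = - (x * C - x1 * S) / 2 -> Y = (x * S + x1 * C) / 2 ->
  4 * Y ^+ 2 = k * (1 - (2 * X - h) ^+ 2).
Proof.
move=> hlt CS; set m := x + h * C => xE x1E XE YE.
have k0 : 0 < k by rewrite subr_gt0 expr_lt1 // ltW.
have m2 : m ^+ 2 = k + h ^+ 2 * C ^+ 2 by rewrite /m -xE; ring.
have m0 : m != 0.
  by rewrite -sqrf_eq0 m2 gt_eqF // ltr_wpDr // mulr_ge0 ?sqr_ge0.
have xm : x = m - h * C by rewrite /m; ring.
have S2 : S ^+ 2 = 1 - C ^+ 2 by move: CS; lra.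
have pE : (2 * X - h) * m = - C.
  transitivity (- x * C * m + (m * x1) * S - h * m); first by rewrite XE; field.
  rewrite x1E (_ : h * S * x * S = h * x * S ^+ 2); last by ring.
  transitivity (- C * (m ^+ 2) + h * m * (C ^+ 2 + S ^+ 2) - h ^+ 2 * C * S ^+ 2 - h * m).
    by rewrite xm; ring.
  by rewrite CS m2 S2; ring.
have qE : 2 * Y * m = k * S.
  transitivity (x * S * m + (m * x1) * C); first by rewrite YE; field.
  rewrite x1E; transitivity (S * (m ^+ 2 - h ^+ 2 * C ^+ 2)); first by rewrite xm; ring.
  by rewrite m2; ring.
apply: (mulIf (expf_neq0 2 m0)).
transitivity ((2 * Y * m) ^+ 2); first by ring.
rewrite qE; transitivity (k * (m ^+ 2 - ((2 * X - h) * m) ^+ 2)); last by ring.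
by rewrite pE m2 exprMn S2; ring.
Qed.

Let A := mxA b 0 d e 0 0 h.
Let hbcd : b ^+ 2 + 0 ^+ 2 + d ^+ 2 = 1.
Proof. by rewrite hb2; ring. Qed.
Let hefgh : e ^+ 2 + 0 ^+ 2 + 0 ^+ 2 + h ^+ 2 = 1.
Proof. by rewrite he2; ring. Qed.
Let hcedf : 0 * e + d * 0 = 0 :> R.
Proof. by ring. Qed.
Let hcg : 0 * 0 = 0 :> R.
Proof. by ring. Qed.

Lemma split_curve_subset : kippenhahn_curve A `<=`
  circle (0 : R[i]) (a1 / 2) `|` circle (0 : R[i]) (a2 / 2) `|` ellipse (0 : R[i]) h%:C 1.
Proof.
move=> z /(kippenhahn_curve_branch hbcd hefgh hcedf hcg).
case: z => X Y /= bp.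
have a10 : 0 <= a1 by exact: sqrtr_ge0.
have a20 : 0 <= a2 by exact: sqrtr_ge0.
have incirc a : a \in rs -> X ^+ 2 + Y ^+ 2 = a ^+ 2 / 4 ->
    (circle (0 : R[i]) (a1 / 2) `|` circle (0 : R[i]) (a2 / 2)) (X +i* Y).
  rewrite !inE => ars XY.
  have : X ^+ 2 + Y ^+ 2 = a1 ^+ 2 / 4 \/ X ^+ 2 + Y ^+ 2 = a2 ^+ 2 / 4.
    by move: ars XY => /or4P[] /eqP ->; rewrite ?sqrrN => ->; [left|left|right|right].
  by move=> [] XY'; [left|right]; apply/circleP; rewrite ?divr_ge0 //= !subr0 XY'; field.
have bp' (p q : {poly R}) rs' :
    (forall x C, E.[x] + C * O.[x] =
       (p.[x] + C * q.[x]) * (\prod_(a <- rs') ('X - a%:P)).[x]) ->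
    branch_point (p * \prod_(a <- rs') ('X - a%:P)) (q * \prod_(a <- rs') ('X - a%:P)) X Y.
  move=> EO; move: bp => [t [x [x1 [xd H XE YE]]]]; exists t, x, x1; split=> //.
  by apply: filterS H => s <-; rewrite EO !hornerM; ring.
have prs x : (\prod_(a <- rs) ('X - a%:P)).[x] = (x ^+ 2 - a1 ^+ 2) * (x ^+ 2 - a2 ^+ 2).
  by rewrite /rs !big_cons big_nil !hornerM !hornerXsubC hornerC; ring.
have [hlt|hge] := ltP h 1.
  have /bp'/branch_pointP : forall x C, E.[x] + C * O.[x] =
       (('X^2 - k%:P).[x] + C * ((2 * h) *: 'X).[x]) * (\prod_(a <- rs) ('X - a%:P)).[x].
    move=> x C; rewrite split_parts prs hornerD hornerN hornerXn hornerC hornerZ hornerX.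
    by ring.
  move=> [[a ars XY]|[t [x [x1 []]]]]; first by left; exact: incirc XY.
  have -> : ('X^2 - k%:P)^`().[x] = 2 * x.
    by rewrite derivB derivXn derivC subr0 hornerMn expr1 hornerX -mulr_natl.
  have -> : ((2 * h) *: 'X)^`().[x] = 2 * h by rewrite derivZ derivX hornerZ hornerC mulr1.
  rewrite hornerD hornerN hornerXn hornerC hornerZ hornerX => F0 F1 XE YE; right.
  apply/ellipse_eqP => //.
  apply: (ellipse_of_branch hlt (cos2Dsin2 t) _ _ XE YE); last by move: F1; lra.
  by move: F0; lra.
(* For [h = 1] the quadratic factor is the product of [x] and
   [x + 2 * cos t], whose envelopes are the points 0 and 1. *)
have h1' : h = 1 by apply/eqP; rewrite eq_le h1 hge.
have /bp'/branch_pointP : forall x C, E.[x] + C * O.[x] =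
    ('X.[x] + C * (2%:P : {poly R}).[x]) * (\prod_(a <- 0 :: rs) ('X - a%:P)).[x].
  move=> x C; rewrite split_parts big_cons hornerM prs hornerXsubC hornerX hornerC h1'.
  by ring.
move=> [[a]|[t [x [x1 []]]]].
  rewrite inE => /orP[/eqP ->|ars XY]; last by left; exact: incirc XY.
  rewrite expr0n mul0r => /eqP; rewrite paddr_eq0 ?sqr_ge0 // !sqrf_eq0.
  move=> /andP[/eqP -> /eqP ->]; right; rewrite /ellipse h1' sub0r normrN normr1 eqxx.
  by left.
rewrite derivX derivC !hornerC hornerX => F0 F1 XE YE; right.
rewrite /ellipse h1' sub0r normrN normr1 eqxx; right.
have xE : x = - (2 * cos t) by move: F0; lra.
have x1E : x1 = 2 * sin t by move: F1; lra.
apply/eqP; rewrite eq_complex /= XE YE xE x1E; apply/andP; split; apply/eqP.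
  by transitivity (cos t ^+ 2 + sin t ^+ 2); [field|exact: cos2Dsin2].
by field.
Qed.

Lemma horner_split_parts_eq0 (x C : R) :
  x ^+ 2 = a1 ^+ 2 \/ x ^+ 2 = a2 ^+ 2 \/ x ^+ 2 + 2 * h * C * x = k ->
  E.[x] + C * O.[x] = 0.
Proof. by rewrite split_parts => -[->|[->|->]]; ring. Qed.

Lemma circle_subset_split_curve a : 0 <= a -> a ^+ 2 = a1 ^+ 2 \/ a ^+ 2 = a2 ^+ 2 ->
  circle (0 : R[i]) (a / 2) `<=` kippenhahn_curve A.
Proof.
move=> a0 aE [X Y] /circleP; rewrite divr_ge0 //= !subr0 => /(_ isT) XY.
have [t [tpi XE YE]] : exists t, [/\ - pi < t <= pi, a / 2 * cos t = X &
    a / 2 * sin t = - Y].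
  have [z0|z0] := eqVneq a 0.
    have [|t [tpi _ _]] := @polar_angle R 1 0; first by rewrite expr1n expr0n addr0.
    move: XY; rewrite z0 mul0r expr0n => /eqP.
    rewrite paddr_eq0 ?sqr_ge0 // !sqrf_eq0 => /andP[/eqP -> /eqP ->].
    by exists t; split; rewrite // ?mul0r ?oppr0.
  have [|t [tpi cE sE]] := @polar_angle R (2 * X / a) (- (2 * Y) / a).
    transitivity (4 * (X ^+ 2 + Y ^+ 2) / a ^+ 2); first by field.
    by rewrite XY; field.
  by exists t; rewrite cE sE; split => //; field.
apply: (branch_kippenhahn_curve hbcd hefgh hcedf hcg (t := t) (l := fun=> a / 2)) => //.
- near=> s; split; last exact: derivable_cst.
  apply: horner_split_parts_eq0; rewrite (_ : (- 2 * (a / 2)) ^+ 2 = a ^+ 2); last by field.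
  by case: aE; [left|right; left].
- rewrite -XE; have -> : Y = - (a / 2 * sin t) by rewrite YE opprK.
  transitivity (a / 2 * (cos t ^+ 2 + sin t ^+ 2)); last by ring.
  by rewrite cos2Dsin2 mulr1.
- apply: (is_derive_eq (is_derive_cst (a / 2) t (1 : R))).
  have -> : Y = - (a / 2 * sin t) by rewrite YE opprK.
  by rewrite -XE; ring.
Unshelve. all: by end_near. Qed.

Lemma foci_subset_split_curve : h = 1 -> [set (0 : R[i]); h%:C] `<=` kippenhahn_curve A.
Proof.
move=> h1' z; have [|t [tpi cE sE]] := @polar_angle R 1 0; first by rewrite expr1n expr0n addr0.
move=> [->|->].
  apply: (branch_kippenhahn_curve hbcd hefgh hcedf hcg (t := t) (l := fun=> 0)) => //.
  - near=> s; split; last exact: derivable_cst.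
    by apply: horner_split_parts_eq0; right; right; rewrite h1'; ring.
  - by ring.
  - by apply: (is_derive_eq (is_derive_cst (0 : R) t (1 : R))); ring.
apply: (branch_kippenhahn_curve hbcd hefgh hcedf hcg (t := t) (l := cos)) => //.
- near=> s; split; last by have [] := is_derive_cos s.
  by apply: horner_split_parts_eq0; right; right; rewrite h1'; ring.
- by rewrite cE h1'; ring.
- by apply: (is_derive_eq (is_derive_cos t)); rewrite h1'; ring.
Unshelve. all: by end_near. Qed.

Lemma ellipse_subset_split_curve : ellipse (0 : R[i]) h%:C 1 `<=` kippenhahn_curve A.
Proof.
have [hlt|hge] := ltP h 1; last first.
  have h1' : h = 1 by apply/eqP; rewrite eq_le h1 hge.
  rewrite /ellipse {1}h1' sub0r normrN normr1 eqxx.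
  exact: foci_subset_split_curve.
move=> [X Y] /(ellipse_eqP _ _ hlt); set p := 2 * X - h => YE.
have k0 : 0 < k by rewrite subr_gt0 expr_lt1 // ltW.
have k0' : k != 0 by rewrite gt_eqF.
have p1 : p ^+ 2 <= 1 by have := sqr_ge0 Y; nra.
have hp : 0 < 1 - h ^+ 2 * p ^+ 2 by nra.
have hp0 : 1 - h ^+ 2 * p ^+ 2 != 0 by rewrite gt_eqF.
(* [(M * p, 2 * Y * M / k)] is the outward unit normal at [X + i Y], and [M] is
   the value at [t] of the square root in the support function
   [(h * cos s + sqrt (h ^+ 2 * cos s ^+ 2 + k)) / 2] of the ellipse. *)
pose M := Num.sqrt (k / (1 - h ^+ 2 * p ^+ 2)).
have M0 : 0 < M by rewrite sqrtr_gt0 divr_gt0.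
have M2 : M ^+ 2 = k / (1 - h ^+ 2 * p ^+ 2) by rewrite sqr_sqrtr // divr_ge0 // ltW.
have Mk : M ^+ 2 = k + h ^+ 2 * (M * p) ^+ 2.
  have : M ^+ 2 * (1 - h ^+ 2 * p ^+ 2) = k by rewrite M2 divfK.
  by rewrite exprMn; lra.
have [|t [tpi cE sE]] := @polar_angle R (M * p) (- (2 * Y * M) / k).
  transitivity (M ^+ 2 * (p ^+ 2 + 4 * Y ^+ 2 / k ^+ 2)); first by field.
  rewrite YE; transitivity (M ^+ 2 * (1 - h ^+ 2 * p ^+ 2) / k); first by field.
  by rewrite M2 divfK // divff.
pose D (s : R) := h ^+ 2 * (cos s * cos s) + k.
have D0 s : 0 < D s by rewrite ltr_wpDl // mulr_ge0 ?sqr_ge0 // -expr2 sqr_ge0.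
have dC (c s : R) := is_derive_cst c s (1 : R).
have dD (s : R) : is_derive s 1 D (- 2 * h ^+ 2 * cos s * sin s).
  have := is_derive_add (is_derive_mul (dC (h ^+ 2) s)
    (is_derive_mul (is_derive_cos s) (is_derive_cos s))) (dC k s).
  by move/is_derive_eq; apply => /=; ring.
have dl (s : R) : is_derive s 1 (fun y => (h * cos y + Num.sqrt (D y)) * 2^-1)
    ((- h * sin s + (2 * Num.sqrt (D s))^-1 * (- 2 * h ^+ 2 * cos s * sin s)) * 2^-1).
  have := is_derive_mul (is_derive_add (is_derive_mul (dC h s) (is_derive_cos s))
    (@is_derive1_comp R Num.sqrt _ s _ _ (is_derive1_sqrt (D0 s)) (dD s))) (dC 2^-1 s).
  by move/is_derive_eq; apply => /=; ring.
have sD : Num.sqrt (D t) = M.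
  rewrite /D cE -expr2 addrC -Mk sqrtr_sqr ger0_norm //; exact: ltW.
apply: (branch_kippenhahn_curve hbcd hefgh hcedf hcg (t := t)
  (l := fun y => (h * cos y + Num.sqrt (D y)) * 2^-1)) => //.
- near=> s; split; last by have [] := dl s.
  apply: horner_split_parts_eq0; right; right.
  transitivity (Num.sqrt (D s) ^+ 2 - h ^+ 2 * (cos s * cos s)); first by field.
  by rewrite sqr_sqrtr ?ltW // /D; ring.
- rewrite sD cE sE.
  transitivity (M * (X * p + (4 * Y ^+ 2) / (2 * k))); last by field.
  by rewrite YE /p; field.
- apply: (is_derive_eq (dl t)); rewrite sD cE sE.
  have M0' : M != 0 by rewrite gt_eqF.
  by rewrite /p; field; rewrite k0' M0'.
Unshelve. all: by end_near. Qed.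

Lemma split_curveE : kippenhahn_curve A =
  circle (0 : R[i]) (a1 / 2) `|` circle (0 : R[i]) (a2 / 2) `|` ellipse (0 : R[i]) h%:C 1.
Proof.
apply/seteqP; split; first exact: split_curve_subset.
rewrite !subUset; split; first split.
- by apply: circle_subset_split_curve; [exact: sqrtr_ge0|left].
- by apply: circle_subset_split_curve; [exact: sqrtr_ge0|right].
- exact: ellipse_subset_split_curve.
Qed.
End SplitCase.

Theorem theorem8p2 (R : realType) (b c d e f g h : R)
    (hb : 0 <= b) (hc : 0 <= c) (hd : 0 <= d) (he : 0 <= e) (hh : 0 <= h)
    (hf0 : c * e = 0 -> 0 <= f) (hf1 : c * e <> 0 -> f <= 0)
    (hbcd : b ^+ 2 + c ^+ 2 + d ^+ 2 = 1)
    (hefgh : e ^+ 2 + f ^+ 2 + g ^+ 2 + h ^+ 2 = 1)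
    (hcedf : c * e + d * f = 0)
    (hce : e = 0 -> c = 0)
    (hh0 : h <> 0) (hcg : c * g = 0) :
  ((exists (a : R[i]) (r : R),
      [/\ 0 < r, circle a r `<=` kippenhahn_curve (mxA b c d e f g h) &
          circle a r <> circle (0 : R[i]) (1 / 2 : R)])
    <-> (d <> 0 /\ c = 0 /\ g = 0)) /\
  ((d <> 0 /\ c = 0 /\ g = 0) ->
    kippenhahn_curve (mxA b c d e f g h) =
      circle (0 : R[i]) (Num.sqrt (1 - d) / 2)
      `|` circle (0 : R[i]) (Num.sqrt (1 + d) / 2)
      `|` ellipse (0 : R[i]) (h%:C) 1).
Proof.
have curve : (d <> 0 /\ c = 0 /\ g = 0) ->
    kippenhahn_curve (mxA b c d e f g h) =
      circle (0 : R[i]) (Num.sqrt (1 - d) / 2)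
      `|` circle (0 : R[i]) (Num.sqrt (1 + d) / 2)
      `|` ellipse (0 : R[i]) (h%:C) 1.
  move=> [/eqP d0 [c0 g0]].
  have f0 : f = 0.
    by move/eqP: hcedf; rewrite c0 mul0r add0r mulf_eq0 (negbTE d0) => /eqP.
  rewrite c0 f0 g0; apply: split_curveE => //.
  - by rewrite lt_neqAle eq_sym hh andbT; apply/eqP.
  - by move: hbcd; rewrite c0; lra.
  - by move: hefgh; rewrite f0 g0; lra.
split => //; split=> [[a [r [r0 sub ne]]]|dcg].
  by have [] := circle_case hbcd hefgh hcedf hce hh0 hcg r0 sub ne.
have d0 : 0 < d by rewrite lt_neqAle eq_sym hd andbT; apply/eqP; case: dcg.
have r0 : 0 < Num.sqrt (1 + d) / 2 by rewrite divr_gt0 // sqrtr_gt0; lra.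
exists 0, (Num.sqrt (1 + d) / 2); split => //.
  by rewrite (curve dcg) => z ?; left; right.
move=> E; have : circle (0 : R[i]) (Num.sqrt (1 + d) / 2) (Num.sqrt (1 + d) / 2)%:C.
  by apply/circleP; rewrite ?ltW //= !subr0; ring.
rewrite E => /circleP; rewrite divr_ge0 //= !subr0 => /(_ isT).
rewrite expr0n addr0 exprMn sqr_sqrtr; last by lra.
by move=> ?; lra.
Qed.
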